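(* For every pair of positive integers $m$ and $n$ with $3 \leq m \leq n$, we have $$\chi_s(C_m \times C_n) = \begin{cases} 6 & \text{if } m=3 \text{ and } n\in\{3,5\};\\ 5 & \text{otherwise.}\end{cases}$$
   Context: All graphs are undirected, finite and simple. $C_n$ denotes the cycle on $n$ vertices ($n\geq 3$). A $k$-star coloring of a graph $G$ is a proper vertex coloring of $G$ with colors from $\{1,\dots,k\}$ such that every path on four vertices in $G$ (as a not necessarily induced subgraph) uses at least three distinct colors. The star chromatic number $\chi_s(G)$ is the smallest integer $k$ such that $G$ has a $k$-star coloring. The tensor product $G \times H$ is the graph with vertex set $V(G)\times V(H)$ in which $(u,v)$ and $(u',v')$ are adjacent if and only if $uu'\in E(G)$ and $vv'\in E(H)$. *)

(* Defs.v *)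
From mathcomp Require Import all_boot.

Set Implicit Arguments.
Unset Strict Implicit.
Unset Printing Implicit Defensive.

Record sgraph := SGraph {
  vertex :> finType;
  adj : rel vertex;
  adj_sym : symmetric adj;
  adj_irrefl : irreflexive adj
}.

Section StarColoring.
Variable G : sgraph.

Definition proper_coloring k (c : {ffun G -> 'I_k}) : bool :=
  [forall x, forall y, adj x y ==> (c x != c y)].

(* A not necessarily induced path x0 - x1 - x2 - x3 on four distinct vertices. *)
Definition is_path4 (p : 4.-tuple G) : bool := uniq p && sorted (@adj G) p.

(* The k colors are 0, ..., k-1 instead of 1, ..., k. *)
Definition star_coloring k (c : {ffun G -> 'I_k}) : bool :=
  proper_coloring c &&
  [forall p : 4.-tuple G, is_path4 p ==> (3 <= #|[set c x | x in p]|)].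

Definition star_colorable k : bool :=
  [exists c : {ffun G -> 'I_k}, star_coloring c].

Lemma star_colorable_ex : exists k, star_colorable k.
Proof.
exists #|G|; apply/existsP; exists [ffun x => enum_rank x].
apply/andP; split.
  apply/forallP=> x; apply/forallP=> y; apply/implyP; rewrite !ffunE.
  apply: contraTneq => /enum_rank_inj ->.
  by rewrite adj_irrefl.
apply/forallP=> p; apply/implyP=> /andP[Up _].
rewrite card_in_imset; last by move=> x y _ _; rewrite !ffunE => /enum_rank_inj.
by rewrite (card_uniqP Up) size_tuple.
Qed.

Definition star_chromatic_number : nat := ex_minn star_colorable_ex.

End StarColoring.

Section Cycle.
Variable n : nat.

(* [ordS i] is i + 1 modulo n.  The conjunct [i != j] is redundant except for
   n = 1, where it removes a loop; C_n is the cycle only for n >= 3. *)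
Definition cycle_adj : rel 'I_n :=
  fun i j => (i != j) && ((ordS i == j) || (ordS j == i)).

Lemma cycle_adj_sym : symmetric cycle_adj.
Proof. by move=> i j; rewrite /cycle_adj eq_sym orbC. Qed.

Lemma cycle_adj_irrefl : irreflexive cycle_adj.
Proof. by move=> i; rewrite /cycle_adj eqxx. Qed.

Definition cycle_graph : sgraph := SGraph cycle_adj_sym cycle_adj_irrefl.

End Cycle.

Section TensorProduct.
Variables G H : sgraph.

Definition tensor_adj : rel (G * H)%type :=
  fun x y => adj x.1 y.1 && adj x.2 y.2.

Lemma tensor_adj_sym : symmetric tensor_adj.
Proof.
by move=> x y; rewrite /tensor_adj (adj_sym x.1) (adj_sym x.2).
Qed.

Lemma tensor_adj_irrefl : irreflexive tensor_adj.
Proof. by move=> x; rewrite /tensor_adj adj_irrefl. Qed.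

Definition tensor_product : sgraph := SGraph tensor_adj_sym tensor_adj_irrefl.

End TensorProduct.

(* Main.v *)
Require Import Defs.
From mathcomp Require Import all_boot zmodp zify.

(** The graph C_m x C_n is 4-regular, and locally it is the diagonal grid on
    the integer plane, in which (a, b) is joined to the four points
    (a +- 1, b +- 1).  Star colourings are local: a proper colouring is a star
    colouring exactly when no walk x0 x1 x2 x3 with x0 <> x2 and x1 <> x3 has
    f x0 = f x2 and f x1 = f x3 [star_colorableP].

    Four colours never suffice.  In a 4-star colouring of a 4-regular graph,
    call a neighbour w of v single if no other neighbour of v has the colour
    of w.  The four neighbours of v share three colours, so at most two of them
    are single.  On the other hand every edge vw has an end that is single for
    the other end: otherwise v has a neighbour u <> w coloured like w, w has a
    neighbour x <> v coloured like v, and u v w x is bicoloured.  There are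
    twice as many edges as vertices, so both bounds are attained: every vertex
    has exactly two single neighbours, and hence sees all three other colours
    [card_singles_eq, rainbow_neighbours].  This amplifies a global count
    into a local constraint that holds around every vertex, and that constraint
    is already unsatisfiable on a 5 by 7 window of the diagonal grid, which an
    exhaustive search confirms [window_not_extends, torus_not_star4].

    The same search, run on all vertices, shows that C_3 x C_3 and C_3 x C_5
    have no 5-star colouring.

    For the colourings, write the cycle C_m as a closed walk in a digraph whose
    vertices are letters, C_n as a closed walk in a second one, and colour
    (i, j) by a fixed table indexed by the letters of i and j.  Since star
    colouring is a condition on 3-step walks, the result is a star colouring as
    soon as the table passes a finite test that involves the two digraphs only,
    not m and n [star_table_colorable].  The digraphs are bouquets of directed
    cycles, called blocks below, that share an initial segment, so blocks can be
    concatenated freely and the lengths of closed walks form a numerical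
    semigroup.  Five colours suffice for tables with
    - one row block of length 3 and column blocks of lengths 4, 6, 7, 9, which
      gives m = 3 and every n >= 4 other than 5;
    - row blocks of lengths 4, 5, 6 and column blocks of lengths 4, 5, 6, 7,
      which gives all m, n >= 4 with m <> 7;
    - one row block of length 7 and column blocks of lengths 4, 5, 6, 7, which
      gives m = 7 and every n >= 4.
    One table with six colours for each exceptional torus completes the proof.
    The tables come from a computer search; only the test is part of the
    proof. *)

Set Implicit Arguments.
Unset Strict Implicit.
Unset Printing Implicit Defensive.

Notation torus m n := (tensor_product (cycle_graph m) (cycle_graph n)).

(** * Star colourings as a condition on walks *)

(** Walks that do not turn back replace paths: the case x0 = x3 of a triangle is
    harmless, because f x1 = f x3 would contradict properness.  This makes the
    condition transfer along locally injective graph morphisms. *)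
Definition locally_star (G : sgraph) (f : G -> nat) : Prop :=
  (forall x y, adj x y -> f x != f y) /\
  (forall x0 x1 x2 x3, adj x0 x1 -> adj x1 x2 -> adj x2 x3 ->
     x0 != x2 -> x1 != x3 -> (f x0 != f x2) || (f x1 != f x3)).

Lemma star_colorableP (G : sgraph) k :
  reflect (exists2 f : G -> nat, (forall x, f x < k) & locally_star f)
          (star_colorable G k).
Proof.
apply: (iffP existsP) => [[c /andP[/forallP Pc /forallP Sc]]|[f fk [Pf Sf]]].
  have cP x y : adj x y -> c x != c y.
    by move=> xy; have /forallP/(_ y)/implyP := Pc x; apply.
  exists (fun x => nat_of_ord (c x)) => [x|]; first exact: ltn_ord.
  split=> [x y /cP|x0 x1 x2 x3 a01 a12 a23 n02 n13]; first by [].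
  rewrite -negb_and; apply/negP=> /andP[/eqP/val_inj e02 /eqP/val_inj e13].
  (* If x0 = x3, then x0 and x1 are adjacent and have the same colour. *)
  have n03 : x0 != x3.
    by apply: contraTneq (cP _ _ a01) => ->; rewrite negbK e13.
  have neq_adj x y : adj x y -> x != y.
    by apply: contraTneq => ->; rewrite adj_irrefl.
  have /implyP/(_ _) := Sc [tuple x0; x1; x2; x3].
  rewrite /is_path4 /= !inE !negb_or a01 a12 a23 n02 n13 n03.
  rewrite !neq_adj // => /(_ isT); apply/negP; rewrite -leqNgt.
  apply: leq_trans (subset_leq_card _) (_ : #|[set c x0; c x1]| <= 2).
    apply/subsetP=> _ /imsetP[x xp ->]; move: xp.
    by rewrite !inE => /or4P[]/eqP->; rewrite -?e02 -?e13 eqxx ?orbT.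
  by rewrite cards2; case: (_ == _).
exists [ffun x => Ordinal (fk x)]; apply/andP; split.
  apply/forallP=> x; apply/forallP=> y; apply/implyP=> /Pf.
  by rewrite !ffunE.
apply/forallP=> p; apply/implyP=> /andP[].
case/tupleP: p => x0 p; case/tupleP: p => x1 p; case/tupleP: p => x2 p.
case/tupleP: p => x3 p; rewrite (tuple0 p) /= !inE !negb_or !andbT.
set c := finfun _; set X := [set _ | _ in _].
move=> /andP[/and3P[_ n02 _] /andP[/andP[_ n13] _]] /and3P[a01 a12 a23].
have cneq x y : f x != f y -> c x != c y by rewrite !ffunE.
have three a b d : c a != c b -> c b != c d -> c a != c d ->
    {subset [:: a; b; d] <= [:: x0; x1; x2; x3]} -> 2 < #|X|.
  move=> ab bd ad sub.
  have U : uniq [:: c a; c b; c d] by rewrite /= !inE negb_or ab ad bd.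
  rewrite -[3]/(size [:: c a; c b; c d]) -(card_uniqP U) subset_leq_card //.
  apply/subsetP=> z zP; have [y yP ->] : exists2 y, y \in [:: a; b; d] & z = c y.
    by apply/mapP.
  by apply/imset_f/sub.
case/orP: (Sf _ _ _ _ a01 a12 a23 n02 n13) => /cneq n.
  apply: (three x0 x1 x2) => //; try by apply/cneq/Pf.
  by move=> y; rewrite !inE => /or3P[]->; rewrite ?orbT.
apply: (three x1 x2 x3) => //; try by apply/cneq/Pf.
by move=> y; rewrite !inE => /or3P[]->; rewrite ?orbT.
Qed.

Lemma star_chromatic_number_eq (G : sgraph) k :
  star_colorable G k.+1 -> ~~ star_colorable G k ->
  star_chromatic_number G = k.+1.
Proof.
move=> ck1 nck; rewrite /star_chromatic_number; case: ex_minnP => j cj minj.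
apply/eqP; rewrite eqn_leq minj //= ltnNge; apply: contra nck => jk.
have /star_colorableP[f fj Sf] := cj.
by apply/star_colorableP; exists f => // x; apply: leq_trans (fj x) jk.
Qed.

(** * Four colours on a 4-regular graph *)

Section Counting.
Variables (G : sgraph) (f : G -> nat).
Hypotheses (f4 : forall x, f x < 4) (Sf : locally_star f).
Hypothesis reg4 : forall v : G, #|[set w | adj v w]| = 4.

Let N (v : G) : {set G} := [set w | adj v w].

Definition singles (v : G) : {set G} :=
  [set w in N v | [forall u in N v, (f u == f w) ==> (u == w)]].

Lemma singlesP v w u : w \in singles v -> u \in N v -> f u = f w -> u = w.
Proof.
rewrite inE => /andP[_ /forallP/(_ u)/implyP S] /S/implyP{}S fuw.
by apply/eqP/S/eqP.
Qed.

(** The colours of single neighbours are distinct and differ from those of the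
    other neighbours; with three single neighbours all three available colours
    would be taken and the fourth neighbour could not be coloured. *)
Lemma card_singles v : #|singles v| <= 2.
Proof.
pose c x := Ordinal (f4 x).
have sub : singles v \subset N v by apply/subsetP=> w; rewrite inE => /andP[].
have inj : {in singles v &, injective c}.
  move=> a b Sa Sb [] fab; apply: (singlesP Sb) => //; exact: (subsetP sub).
have cN : #|c @: N v| <= 3.
  apply: (@leq_trans #|~: [set c v]|); last by rewrite cardsC1 card_ord.
  apply/subset_leq_card/subsetP=> _ /imsetP[w vw ->]; rewrite !inE eq_sym.
  by rewrite inE in vw; apply: Sf.1.
have disj : [disjoint c @: singles v & c @: (N v :\: singles v)].
  rewrite -setI_eq0; apply/eqP/setP=> z; rewrite !inE; apply/negP.
  case/andP=> /imsetP[a Sa ->] /imsetP[b]; rewrite inE => /andP[nSb Nb] [] fab.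
  by rewrite (singlesP Sa Nb) ?Sa in nSb.
have := reg4 v; rewrite -/(N v) -(cardsID (singles v) (N v)) (setIidPr sub).
move: cN; rewrite -{1}(setID (N v) (singles v)) (setIidPr sub) imsetU cardsU.
rewrite (disjoint_setI0 disj) cards0 subn0 (card_in_imset inj).
case: (set_0Vmem (N v :\: singles v)) => [-> | [u Du]].
  by rewrite imset0 !cards0; lia.
have : 0 < #|c @: (N v :\: singles v)|.
  by rewrite card_gt0; apply/set0Pn; exists (c u); apply: imset_f.
lia.
Qed.

Lemma not_singleP v w : adj v w -> w \notin singles v ->
  exists u, [/\ adj v u, u != w & f u = f w].
Proof.
rewrite !inE => -> /=; rewrite negb_forall => /existsP[u].
by rewrite !negb_imply inE => /and3P[vu /eqP fuw uw]; exists u.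
Qed.

(** If neither end is single for the other, the edge is the middle edge of a
    bicoloured path. *)
Lemma edge_single v w : adj v w -> (w \in singles v) || (v \in singles w).
Proof.
move=> vw; have wv : adj w v by rewrite adj_sym.
apply: contraT; rewrite negb_or => /andP[].
move=> /(not_singleP vw)[u [vu uw fu]] /(not_singleP wv)[x [wx xv fx]].
have uv : adj u v by rewrite adj_sym.
by have := Sf.2 _ _ _ _ uv vw wx uw; rewrite eq_sym fu fx !eqxx; apply.
Qed.

(** Double counting of the pairs (v, w) with w single at v: by [edge_single]
    there are at least as many as edges, that is 2 |G|, and by [card_singles]
    at most 2 for each vertex. *)
Lemma card_singles_eq v : #|singles v| = 2.
Proof.
have cnt (A : {set G}) : #|A| = \sum_w (w \in A) by rewrite -sum1_card big_mkcond.
have le4 : \sum_(v : G) 4 <= \sum_v #|singles v| + \sum_v #|singles v|.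
  have -> : \sum_(v : G) 4 = \sum_v \sum_w (w \in N v).
    by apply: eq_bigr => u _; rewrite -cnt reg4.
  have e1 : \sum_v #|singles v| = \sum_v \sum_w (w \in singles v).
    by apply: eq_bigr => u _; apply: cnt.
  have e2 : \sum_v #|singles v| = \sum_v \sum_w (v \in singles w).
    by rewrite exchange_big.
  rewrite {1}e1 e2 -big_split.
  apply: leq_sum => u _; rewrite -big_split; apply: leq_sum => w _ /=.
  rewrite inE; case: (boolP (adj u w)) => [/edge_single|_]; last exact: leq0n.
  by case: (w \in singles u); case: (u \in singles w).
have : \sum_(v : G) (2 - #|singles v|) = 0.
  apply/eqP; rewrite sumnB; last by move=> u _; apply: card_singles.
  rewrite subn_eq0 -(leq_pmul2l (isT : 0 < 2)) big_distrr /=.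
  by rewrite [leqRHS]mul2n -addnn.
move/eqP; rewrite sum_nat_eq0 => /forallP/(_ v) /=.
by rewrite subn_eq0 => ?; apply/eqP; rewrite eqn_leq card_singles.
Qed.

(** The two neighbours that are not single form the only monochromatic pair, so
    a second monochromatic pair must coincide with the first. *)
Lemma rainbow_neighbours v a b a' b' :
  adj v a -> adj v b -> adj v a' -> adj v b' -> a != b -> a' != b' ->
  f a = f b -> f a' = f b' -> (a' \in [:: a; b]) && (b' \in [:: a; b]).
Proof.
move=> va vb va' vb' ab ab' fab fab'.
have out x y : adj v x -> adj v y -> x != y -> f x = f y -> x \in N v :\: singles v.
  move=> vx vy xy fxy; rewrite in_setD [x \in N v]inE vx andbT.
  apply: contra xy => Sx; apply/eqP/esym; apply: (singlesP Sx) => //.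
  by rewrite inE.
have cD : #|N v :\: singles v| = 2.
  have := cardsID (singles v) (N v); rewrite reg4.
  rewrite (setIidPr _) ?card_singles_eq; first by lia.
  by apply/subsetP=> w; rewrite inE => /andP[].
have eD : [set a; b] = N v :\: singles v.
  apply/eqP; rewrite eqEcard cards2 ab cD leqnn andbT.
  apply/subsetP=> z; rewrite in_set2.
  by case/pred2P=> ->; [apply: (out _ b) | apply: (out _ a); rewrite // eq_sym].
have := out b' a' vb' va'; rewrite eq_sym => /(_ ab' (esym fab')).
have := out a' b' va' vb' ab' fab'.
by rewrite -eD !in_set2 !inE => -> ->.
Qed.

End Counting.

(** * Exhaustive search for colourings of finite patches *)

(** A clause demands that at least one of the listed pairs of positions get two
    different colours.  Being phrased by disequalities only, clauses are
    invariant under permutations of the colours. *)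
Definition clause := seq (nat * nat).

Definition holds (s : seq nat) (C : clause) : bool :=
  has (fun p => nth 0 s p.1 != nth 0 s p.2) C.

Definition last_index (C : clause) : nat :=
  foldr (fun p i => maxn (maxn p.1 p.2) i) 0 C.

(** Clauses are tested as soon as their last position is coloured.  A clause
    with a position outside the patch belongs to no level, so it is ignored. *)
Definition levels (n : nat) (cls : seq clause) : seq (seq clause) :=
  [seq [seq C <- cls | last_index C == i] | i <- iota 0 n].

(** Here b bounds the colours used so far.  Trying only the colours 0, ..., b
    for the next position breaks the symmetry between unused colours.  The
    conditional, unlike a boolean conjunction, cuts failed branches under
    call-by-value evaluation. *)
Fixpoint extends k (b : nat) (Ls : seq (seq clause)) (s : seq nat) : bool :=
  if Ls is L :: Ls' then
    has (fun a => let s' := rcons s a in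
                  if all (holds s') L then extends k (maxn b a.+1) Ls' s'
                  else false)
        (iota 0 (minn k b.+1))
  else true.

Definition satisfies t (C : clause) :=
  all (fun p => (p.1 < size t) && (p.2 < size t)) C -> holds t C.

Lemma holds_take t n C : all (fun p => (p.1 < n) && (p.2 < n)) C ->
  holds (take n t) C = holds t C.
Proof.
by move=> /allP CP; apply: eq_in_has => p /CP /andP[h1 h2]; rewrite !nth_take.
Qed.

Lemma holds_map (g : nat -> nat) t C : injective g ->
  all (fun p => (p.1 < size t) && (p.2 < size t)) C ->
  holds [seq g x | x <- t] C = holds t C.
Proof.
move=> gI /allP CP; apply: eq_in_has => p /CP /andP[h1 h2].
by rewrite !(nth_map 0) ?(inj_eq gI).
Qed.

Definition swap (a b x : nat) := if x == a then b else if x == b then a else x.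

Lemma swap_inj a b : injective (swap a b).
Proof.
by move=> x y; rewrite /swap; do !case: eqP => // ?; lia.
Qed.

Lemma level_indices C i : last_index C <= i ->
  all (fun p => (p.1 < i.+1) && (p.2 < i.+1)) C.
Proof.
elim: C => //= p C IH; rewrite !geq_max => /andP[/andP[h1 h2] /IH ->].
by rewrite !ltnS h1 h2.
Qed.

(** If the colour a of t at position i exceeds b, then both a and b are absent
    from the first i entries of t, and exchanging them throughout t produces
    another solution with the same beginning and next colour b. *)
Lemma extends_complete k n cls b i t :
  size t = n -> i <= n -> b <= k -> all (fun x => x < b) (take i t) ->
  all (fun x => x < k) t ->
  (forall C, C \in cls -> satisfies t C) ->
  extends k b (drop i (levels n cls)) (take i t).
Proof.
move: {2}(n - i) (leqnn (n - i)) => d.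
elim: d i b t => [|d IH] i b t.
  move=> ? st ? _ _ _ _; rewrite drop_oversize // size_map size_iota; lia.
move=> ni st i_n bk sb tk ct; case: (ltngtP i n) i_n => // [i_n|->] _; last first.
  by rewrite drop_oversize // size_map size_iota.
rewrite (drop_nth [::]) ?size_map ?size_iota //= (nth_map 0) ?size_iota //.
rewrite nth_iota // add0n.
(* Exchanging the next colour with b makes it at most b. *)
pose a := nth 0 t i; wlog ab : t @a st sb tk ct / a <= b.
  move=> W; case: (leqP a b) => [|ba]; first exact: W.
  have ak : a < k by apply: (allP tk); rewrite mem_nth ?st.
  pose t' := [seq swap a b x | x <- t].
  have take' : take i t' = take i t.
    rewrite -map_take; apply/map_id_in => x /(allP sb) xb.
    by rewrite /swap; case: eqP => [|_]; [lia | case: eqP => //; lia].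
  rewrite -take'; apply: W; rewrite ?take' ?size_map //.
  - apply/allP=> _ /mapP[x /(allP tk) xk ->]; rewrite /swap.
    by do !case: eqP => // _; lia.
  - move=> C /ct sC; rewrite /satisfies size_map => wC.
    by rewrite holds_map //; [apply: sC | apply: swap_inj].
  by rewrite (nth_map 0) ?st // /swap eqxx.
have ak : a < k by apply: (allP tk); rewrite mem_nth ?st.
apply/hasP; exists a; first by rewrite mem_iota leq_min; lia.
have e : rcons (take i t) a = take i.+1 t by rewrite -take_nth ?st.
rewrite e ifT; last first.
  apply/allP=> C; rewrite mem_filter => /andP[/eqP lC /ct sC].
  have wC := level_indices (eq_leq lC).
  rewrite holds_take //; apply: sC; apply: sub_all wC => p; rewrite st; lia.
apply: IH => //; try lia.
rewrite -e all_rcons; apply/andP; split; first by lia.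
by apply: sub_all sb => x; lia.
Qed.

(** A patch is a list P of points with an adjacency relation e; the clauses on P
    express necessary conditions on the colouring that a star colouring of G
    induces on P along a locally injective morphism h from P to G. *)
Section Patches.
Variables (T : eqType) (P : seq T) (e : rel T).

Definition indices (C : seq (T * T)) : clause :=
  [seq (index p.1 P, index p.2 P) | p <- C].

Lemma coloring_extends k cls (g : T -> nat) :
  (forall x, g x < k) ->
  (forall C, C \in cls -> has (fun p => g p.1 != g p.2) C) ->
  extends k 0 (levels (size P) [seq indices C | C <- cls]) [::].
Proof.
move=> gk gC; pose t := [seq g x | x <- P].
rewrite -(take0 t) -[levels _ _]drop0.
apply: extends_complete; rewrite ?size_map ?take0 //.
  by apply/allP=> _ /mapP[x _ ->].
move=> _ /mapP[C /gC /hasP[p pC gp] ->] /allP W; apply/hasP.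
exists (index p.1 P, index p.2 P); first by apply: map_f.
have /andP[] := W _ (map_f _ pC); rewrite /= size_map !index_mem => P1 P2.
by rewrite !(nth_map p.1) ?index_mem ?nth_index.
Qed.

Let nbs x := [seq y <- P | e x y].

Definition edge_clauses : seq (seq (T * T)) :=
  [seq [:: (x, y)] | x <- P, y <- nbs x].

(** The paths x0 x1 x2 x3, enumerated by their middle edge m = (x1, x2). *)
Definition path_clauses : seq (seq (T * T)) :=
  [seq [:: (q.1, m.2); (m.1, q.2)]
  | m <- [seq (x1, x2) | x1 <- P, x2 <- nbs x1],
    q <- [seq (x0, x3) | x0 <- [seq x <- nbs m.1 | x != m.2],
                         x3 <- [seq x <- nbs m.2 | x != m.1]]].

Let pairs x :=
  [seq p <- [seq (y, z) | y <- nbs x, z <- nbs x] | index p.1 P < index p.2 P].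

(** The additional clauses that hold for four colours on a 4-regular graph, by
    [rainbow_neighbours]. *)
Definition rainbow_clauses : seq (seq (T * T)) :=
  flatten [seq [seq [:: p; q] | p <- pairs x, q <- [seq q <- pairs x | q != p]]
          | x <- P].

Section Valid.
Variables (G : sgraph) (h : T -> G) (f : G -> nat).
Hypothesis e_sym : symmetric e.
Hypothesis h_adj : forall x y, e x y -> adj (h x) (h y).
Hypothesis h_inj : forall x y z, e y x -> e y z -> x != z -> h x != h z.
Hypothesis Sf : locally_star f.

Lemma star_clauses_valid C : C \in edge_clauses ++ path_clauses ->
  has (fun p => f (h p.1) != f (h p.2)) C.
Proof.
rewrite mem_cat => /orP[].
  case/allpairsPdep=> x [y []]; rewrite mem_filter => Px /andP[exy Py] ->.
  by rewrite /= orbF Sf.1 ?h_adj.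
case/allpairsPdep=> m [q [/allpairsPdep[x1 [x2 [_ +]]]]].
rewrite mem_filter => /andP[e12 _] ->.
case/allpairsPdep=> x0 [x3 []]; rewrite !mem_filter /=.
move=> /and3P[n02 e10 _] /and3P[n31 e23 _] -> -> /=; rewrite orbF.
apply: Sf.2 (h_adj e12) (h_adj e23) _ _; first by rewrite adj_sym h_adj.
  exact: h_inj e10 e12 n02.
by rewrite eq_sym (h_inj e23 _ n31) // e_sym.
Qed.

Lemma rainbow_clauses_valid C :
  (forall x, f x < 4) -> (forall v : G, #|[set w | adj v w]| = 4) ->
  C \in rainbow_clauses -> has (fun p => f (h p.1) != f (h p.2)) C.
Proof.
move=> f4 reg4 /flatten_mapP[x Px /allpairsPdep[p [q [+ + ->]]]].
have pairsP r : r \in pairs x ->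
    [/\ e x r.1, e x r.2 & index r.1 P < index r.2 P].
  rewrite mem_filter => /andP[lt /allpairsPdep[y [z []]]].
  by rewrite !mem_filter => /andP[? _] /andP[? _] er; rewrite er /= in lt *.
rewrite mem_filter => /pairsP[p1 p2 lp] /andP[qp /pairsP[q1 q2 lq]].
apply: contraT; rewrite /= !negb_or !negbK => /and3P[/eqP fp /eqP fq _].
have ne r : index r.1 P < index r.2 P -> r.1 != r.2 :> T.
  by apply: contraTneq => ->; rewrite ltnn.
have hI y z : e x y -> e x z -> h y = h z -> y = z.
  by move=> ey ez /eqP; apply: contraTeq; apply: h_inj ey ez.
have := rainbow_neighbours f4 Sf reg4 (h_adj p1) (h_adj p2) (h_adj q1) (h_adj q2).
move=> /(_ (h_inj p1 p2 (ne _ lp)) (h_inj q1 q2 (ne _ lq)) fp fq).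
rewrite !inE => /andP[h1 h2].
suff eq_qp : q = p by rewrite eq_qp eqxx in qp.
rewrite [q]surjective_pairing [p]surjective_pairing; move: lp lq.
case/pred2P: h1 => /(hI _ _ q1) -> //; case/pred2P: h2 => /(hI _ _ q2) -> //.
- by rewrite ltnn.
- by case: ltngtP.
by rewrite ltnn.
Qed.
End Valid.
End Patches.

(** * Five colours are needed *)

Lemma ordS_inZp m a : ordS (inZp a : 'I_m.+1) = inZp a.+1.
Proof. by apply: val_inj; rewrite /= -addn1 modnDml addn1. Qed.

Lemma inZp_neq m a d : 0 < d < m.+1 -> (inZp a : 'I_m.+1) != inZp (a + d).
Proof.
move=> dm; apply/negP=> /eqP/(congr1 val)/= /eqP.
by rewrite -{1}[a]addn0 eqn_modDl mod0n modn_small; lia.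
Qed.

Definition near : rel nat := fun a b => (a.+1 == b) || (b.+1 == a).

Lemma near_adj m a b : near a b -> cycle_adj (inZp a : 'I_m.+3) (inZp b).
Proof.
have neqS c : (inZp c : 'I_m.+3) != inZp c.+1 by rewrite -[in c.+1]addn1 inZp_neq.
rewrite /cycle_adj !ordS_inZp => /pred2P[]<-; rewrite eqxx ?orbT andbT //.
by rewrite eq_sym.
Qed.

(** Distinct neighbours of an integer differ by 2, less than the modulus m.+3. *)
Lemma near_inj m b a c : near b a -> near b c -> a != c ->
  (inZp a : 'I_m.+3) != inZp c.
Proof.
have neqSS d : (inZp d : 'I_m.+3) != inZp d.+2 by rewrite -[in d.+2]addn2 inZp_neq.
move=> /pred2P ba /pred2P bc /eqP ac.
have [->|->] : a = c.+2 \/ c = a.+2 by lia.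
  by rewrite eq_sym.
by [].
Qed.

Lemma card_cycle_neighbours m (i : 'I_m.+3) : #|[set j | cycle_adj i j]| = 2.
Proof.
have [a ->] : exists a, i = inZp a.+1.
  exists (i + m.+2); apply: val_inj.
  by rewrite /= -addnS modnDr modn_small.
have -> : [set j | cycle_adj (inZp a.+1) j] = [set inZp a; inZp a.+2] :> {set 'I_m.+3}.
  apply/setP=> j; rewrite !inE; apply/idP/idP => [|/pred2P[]->]; last 2 first.
  - by rewrite near_adj // /near eqxx orbT.
  - by rewrite near_adj // /near eqxx.
  case/andP=> _ /orP[/eqP<-|/eqP]; first by rewrite ordS_inZp eqxx orbT.
  by rewrite -ordS_inZp => /ordS_inj ->; rewrite eqxx.
by rewrite cards2 -[in a.+2]addn2 inZp_neq.
Qed.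

Lemma card_neighbours m n (v : torus m.+3 n.+3) : #|[set w | adj v w]| = 4.
Proof.
have -> : [set w | adj v w] =
    setX [set j | cycle_adj v.1 j] [set j | cycle_adj v.2 j].
  by apply/setP=> w; rewrite !inE.
by rewrite cardsX !card_cycle_neighbours.
Qed.

(** The diagonal grid, which covers every torus. *)
Definition diagonal : rel (nat * nat) := fun p q => near p.1 q.1 && near p.2 q.2.

(** The diagonal grid on a 5 by 7 rectangle has two components, separated by the
    parity of the coordinate sum; this is the larger one. *)
Definition window : seq (nat * nat) :=
  [seq p <- [seq (a, b) | a <- iota 0 5, b <- iota 0 7] | ~~ odd (p.1 + p.2)].

Lemma window_not_extends :
  ~~ extends 4 0 (levels (size window)
     [seq indices window C
     | C <- (edge_clauses window diagonal ++ path_clauses window diagonal)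
            ++ rainbow_clauses window diagonal]) [::].
Proof. by vm_compute. Qed.

Lemma torus_not_star4 m n : ~~ star_colorable (torus m.+3 n.+3) 4.
Proof.
apply/negP=> /star_colorableP[f f4 Sf].
pose h (p : nat * nat) : torus m.+3 n.+3 := (inZp p.1, inZp p.2).
have h_adj p q : diagonal p q -> adj (h p) (h q).
  by case/andP=> e1 e2; apply/andP; split; apply: near_adj.
have h_inj p q r : diagonal q p -> diagonal q r -> p != r -> h p != h r.
  case/andP=> qp1 qp2 /andP[qr1 qr2]; rewrite /h xpair_eqE negb_and.
  case: (eqVneq p.1 r.1) => [e1|/(near_inj m qp1 qr1) -> //] pr.
  rewrite (near_inj n qp2 qr2) ?orbT //; apply: contraNneq pr => e2.
  by rewrite [p]surjective_pairing e1 e2 -surjective_pairing.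
have diagonal_sym : symmetric diagonal.
  by move=> p q; rewrite /diagonal /near (orbC (p.1.+1 == _)) (orbC (p.2.+1 == _)).
apply: (negP window_not_extends).
apply: (@coloring_extends _ _ _ _ (f \o h)) => [p|C]; first exact: f4.
rewrite mem_cat => /orP[].
  exact: star_clauses_valid.
apply: rainbow_clauses_valid => //; exact: card_neighbours.
Qed.

(** * Two tori that need six colours *)

Definition refuted (G : sgraph) k (P : seq G) : bool :=
  ~~ extends k 0 (levels (size P)
     [seq indices P C | C <- edge_clauses P (@adj G) ++ path_clauses P (@adj G)]) [::].

Lemma refutedP (G : sgraph) k (P : seq G) : refuted k P -> ~~ star_colorable G k.
Proof.
move=> R; apply/negP=> /star_colorableP[f fk Sf]; apply: (negP R).
apply: (@coloring_extends G P k _ f fk) => C.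
by apply: (star_clauses_valid (h := id)) => //; apply: adj_sym.
Qed.

Lemma torus33_not_star5 : ~~ star_colorable (torus 3 3) 5.
Proof.
apply: (@refutedP (torus 3 3) 5 [seq (inZp a, inZp b) | a <- iota 0 3, b <- iota 0 3]).
by vm_compute.
Qed.

Lemma torus35_not_star5 : ~~ star_colorable (torus 3 5) 5.
Proof.
(* The vertices are ordered such that each has many neighbours before it, which
   keeps the search tree small. *)
apply: (@refutedP (torus 3 5) 5 [seq (inZp p.1, inZp p.2) | p <-
  [:: (0, 0); (1, 1); (0, 2); (2, 1); (1, 0); (2, 4); (1, 3); (0, 4); (2, 0);
      (0, 1); (2, 2); (0, 3); (1, 2); (1, 4); (2, 3)]]).
by vm_compute.
Qed.

(** * Colourings from tables *)

(** The digraph formed by the directed cycles bs. *)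
Definition block_arc (bs : seq (seq nat)) : rel nat :=
  fun x y => has (fun b => (x \in b) && (next b x == y)) bs.

(** A step along an edge of C_m moves the letter along an arc or against it. *)
Definition directed (E : rel nat) (d : bool) : rel nat :=
  fun x y => if d then E x y else E y x.

(** A walk is kept as its directions and its letters, the latest first.  A change
    of direction returns to the previous position of the cycle, hence to the
    previous letter, although the digraph may offer other arcs. *)
Definition grow (N : seq nat) (E : rel nat) (w : seq bool * seq nat) :
    seq (seq bool * seq nat) :=
  [seq (d :: w.1, y :: w.2)
  | d <- [:: true; false],
    y <- [seq y <- N | directed E d (head 0 w.2) y
                       && ((head d w.1 == d) || (y == nth 0 w.2 1))]].

Definition walks l N E :=
  iter l (fun ws => flatten [seq grow N E w | w <- ws]) [seq ([::], [:: x]) | x <- N].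

Definition entry (F : seq (seq nat)) x y := nth 0 (nth [::] F x) y.

(** A walk of the torus projects to a walk in each cycle, and it turns back at a
    step only if both projections do; hence pairs of walks that turn at the same
    time are exempt from the test. *)
Definition star_table k (N N' : seq nat) (E E' : rel nat) (F : seq (seq nat)) : bool :=
  let c (w w' : seq bool * seq nat) i := entry F (nth 0 w.2 i) (nth 0 w'.2 i) in
  let straight (w : seq bool * seq nat) i := nth true w.1 i == nth true w.1 i.+1 in
  [&& (0 < k) && all (all (fun a => a < k)) F,
      all (fun w => all (fun w' => c w w' 0 != c w w' 1) (walks 1 N' E')) (walks 1 N E)
    & all (fun w => all (fun w' =>
          [|| ~~ (straight w 0 || straight w' 0), ~~ (straight w 1 || straight w' 1),
              c w w' 0 != c w w' 2 | c w w' 1 != c w w' 3])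
        (walks 3 N' E')) (walks 3 N E)].

Section Words.
Variables (m : nat) (N : seq nat) (E : rel nat) (w : 'I_m -> nat).
Hypothesis wN : forall i, w i \in N.
Hypothesis wE : forall i, E (w i) (w (ordS i)).

Let forward (i j : 'I_m) := ordS i == j.

Lemma directed_forward i j : cycle_adj i j ->
  directed E (forward i j) (w i) (w j).
Proof.
rewrite /forward => /andP[_]; case: (boolP (ordS i == j)) => [/eqP<- _|_ /= /eqP<-];
  exact: wE.
Qed.

(** [ordS] is injective, so a change of direction undoes the last step. *)
Lemma turn_back i j l : cycle_adj i j -> cycle_adj j l ->
  forward i j != forward j l -> i = l.
Proof.
rewrite /forward => /andP[_ ij] /andP[_ jl].
case: (boolP (ordS i == j)) ij jl => [/eqP<- _ jl|_ /= /eqP ji jl].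
  case: (boolP (ordS (ordS i) == l)) jl => //= _ /eqP jl _.
  by rewrite (ordS_inj jl).
by rewrite ji; case: (i =P l) => //=.
Qed.

Lemma grow_walk l ds xs i j : cycle_adj i j -> (ds, w i :: xs) \in walks l N E ->
  (head (forward i j) ds == forward i j) || (w j == head 0 xs) ->
  (forward i j :: ds, [:: w j, w i & xs]) \in walks l.+1 N E.
Proof.
move=> ij Hw turn; apply/flatten_mapP; exists (ds, w i :: xs) => //.
apply/allpairsPdep; exists (forward i j), (w j); split=> //.
  by case: forward.
by rewrite mem_filter wN andbT directed_forward //= nth0.
Qed.

Lemma walk0 i : ([::], [:: w i]) \in walks 0 N E.
Proof. by apply: map_f (wN i). Qed.

Lemma walk1 i j : cycle_adj i j ->
  ([:: forward i j], [:: w j; w i]) \in walks 1 N E.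
Proof. by move=> ij; apply: (grow_walk ij (walk0 i)); rewrite /= eqxx. Qed.

Lemma turn_or i j l : cycle_adj i j -> cycle_adj j l ->
  (forward i j == forward j l) || (w l == w i).
Proof.
move=> ij jl; case: (boolP (_ == _)) => //= /(turn_back ij jl) ->.
exact: eqxx.
Qed.

Lemma walk3 i0 i1 i2 i3 : cycle_adj i0 i1 -> cycle_adj i1 i2 -> cycle_adj i2 i3 ->
  ([:: forward i2 i3; forward i1 i2; forward i0 i1], [:: w i3; w i2; w i1; w i0])
    \in walks 3 N E.
Proof.
move=> a01 a12 a23; apply: (grow_walk a23); last exact: turn_or.
by apply: (grow_walk a12); [apply: walk1 | apply: turn_or].
Qed.
End Words.

(** The walks of length 1 in the test give properness, those of length 3 the
    star condition.  The letters r and s spell out C_m and C_n as closed walks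
    in the two digraphs. *)
Lemma star_table_colorable k m n N N' E E' F (r : 'I_m -> nat) (s : 'I_n -> nat) :
  star_table k N N' E E' F ->
  (forall i, r i \in N) -> (forall i, E (r i) (r (ordS i))) ->
  (forall j, s j \in N') -> (forall j, E' (s j) (s (ordS j))) ->
  star_colorable (torus m n) k.
Proof.
move=> /and3P[/andP[k0 /allP Fk] /allP T1 /allP T3] rN rE sN sE.
apply/star_colorableP; exists (fun v : torus m n => entry F (r v.1) (s v.2)) => [v|].
  rewrite /entry; case: (ltnP (r v.1) (size F)) => [lr|]; last first.
    by move/(nth_default [::])->; rewrite nth_nil.
  case: (ltnP (s v.2) (size (nth [::] F (r v.1)))) => [ls|/(nth_default 0)-> //].
  by apply: (allP (Fk _ (mem_nth [::] lr))); apply: mem_nth.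
split=> [x y /andP[a1 a2]|x0 x1 x2 x3 /andP[a01 b01] /andP[a12 b12] /andP[a23 b23]].
  by rewrite eq_sym; apply: (allP (T1 _ (walk1 rN rE a1)) _ (walk1 sN sE a2)).
move=> n02 n13.
have := allP (T3 _ (walk3 rN rE a01 a12 a23)) _ (walk3 sN sE b01 b12 b23).
rewrite /= !negb_or => /or4P[/andP[t1 t2]|/andP[t1 t2]|t|t].
- case/eqP: n13; rewrite [x1]surjective_pairing [x3]surjective_pairing.
  by congr pair; [apply: turn_back a12 a23 _ | apply: turn_back b12 b23 _];
    rewrite eq_sym.
- case/eqP: n02; rewrite [x0]surjective_pairing [x2]surjective_pairing.
  by congr pair; [apply: turn_back a01 a12 _ | apply: turn_back b01 b12 _];
    rewrite eq_sym.
- by rewrite orbC eq_sym t.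
by rewrite eq_sym t.
Qed.

(** Closed walks from the letter 0 to itself; the default 1 excludes the empty
    word. *)
Definition loop (E : rel nat) (r : seq nat) := (head 1 r == 0) && cycle E r.

Lemma loop_cat E r s : loop E r -> loop E s -> loop E (r ++ s).
Proof.
case: r => [|x p] // /andP[/= /eqP-> pP]; case: s => [|y q] // /andP[/= /eqP-> qP].
by rewrite /loop /= rcons_cat rcons_cons -cat_rcons cat_path pP last_rcons.
Qed.

(** Prepending copies of u realises every length that is congruent modulo the
    length of u to that of a known closed walk, and not smaller. *)
Lemma loop_of_size E u ws n : loop E u -> all (loop E) ws ->
  has (fun r => (size r <= n) && (n == size r %[mod size u])) ws ->
  exists2 r, loop E r & size r = n.
Proof.
move=> Lu /allP Lws /hasP[r /Lws Lr /andP[rn]].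
rewrite eqn_mod_dvd // => /dvdnP[q nq].
have -> : n = q * size u + size r by rewrite -nq subnK.
elim: q {nq} => [|q [p Lp sp]]; first by exists r.
by exists (u ++ p); [apply: loop_cat | rewrite size_cat sp mulSn addnA].
Qed.

Lemma loop_nth E r i : loop E r -> i < size r ->
  E (nth 0 r i) (nth 0 r (i.+1 %% size r)).
Proof.
case: r => [|x p] // /andP[_ /= /(pathP 0) P] lip.
have := P i; rewrite size_rcons => /(_ lip).
rewrite -rcons_cons nth_rcons /= lip.
rewrite nth_rcons; move: lip; rewrite ltnS leq_eqVlt => /predU1P[->|lip].
  by rewrite ltnn eqxx modnn.
by rewrite lip modn_small.
Qed.

(** * The tables *)

Definition blocks3 := [:: iota 0 3].
Definition blocks5 := [:: iota 0 5].
Definition blocks7 := [:: iota 0 7].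
Definition blocks4679 :=
  [:: [:: 0; 1; 2; 3]; [:: 0; 1; 2; 3; 4; 5]; [:: 0; 1; 2; 3; 6; 7; 8];
      [:: 0; 1; 2; 3; 9; 10; 11; 12; 13]].
Definition blocks4567 :=
  [:: [:: 0; 1; 2; 3]; [:: 0; 1; 2; 4; 5]; [:: 0; 1; 2; 6; 7; 8];
      [:: 0; 1; 2; 9; 10; 11; 12]].
Definition blocks456 :=
  [:: [:: 0; 1; 2; 3]; [:: 0; 1; 4; 5; 6]; [:: 0; 1; 7; 8; 9; 10]].

Definition table_3_4679 :=
  [:: [:: 0; 4; 1; 0; 3; 2; 0; 0; 2; 0; 4; 3; 3; 2];
      [:: 3; 3; 2; 2; 3; 2; 3; 3; 2; 3; 4; 0; 0; 2];
      [:: 1; 4; 1; 4; 4; 1; 4; 4; 1; 1; 1; 2; 4; 1]].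

Definition table_456_4567 :=
  [:: [:: 4; 2; 3; 2; 0; 1; 0; 0; 1; 0; 0; 4; 1];
      [:: 0; 2; 1; 2; 4; 3; 4; 4; 2; 4; 2; 2; 3];
      [:: 1; 2; 0; 2; 2; 2; 3; 3; 2; 3; 3; 4; 4];
      [:: 3; 2; 4; 2; 4; 3; 1; 4; 2; 1; 1; 2; 0];
      [:: 1; 3; 0; 4; 2; 2; 2; 3; 2; 4; 3; 0; 4];
      [:: 1; 2; 0; 2; 3; 4; 1; 3; 0; 2; 3; 2; 4];
      [:: 3; 2; 4; 2; 2; 2; 1; 2; 2; 1; 1; 2; 0];
      [:: 1; 3; 0; 4; 2; 2; 2; 3; 2; 4; 3; 0; 4];
      [:: 1; 3; 0; 3; 3; 4; 2; 3; 0; 2; 1; 0; 4];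
      [:: 2; 2; 4; 2; 1; 2; 1; 1; 0; 2; 1; 3; 2];
      [:: 4; 1; 3; 0; 0; 3; 2; 2; 3; 2; 1; 3; 0]].

Definition table_7_4567 :=
  [:: [:: 4; 4; 0; 0; 0; 0; 0; 2; 0; 0; 2; 2; 0];
      [:: 2; 2; 2; 2; 4; 2; 4; 4; 0; 4; 3; 4; 0];
      [:: 3; 3; 1; 1; 1; 1; 1; 1; 1; 1; 3; 1; 1];
      [:: 0; 2; 0; 2; 3; 0; 3; 3; 0; 2; 4; 0; 0];
      [:: 4; 4; 0; 2; 2; 2; 2; 2; 2; 2; 4; 2; 2];
      [:: 0; 3; 0; 3; 1; 0; 1; 1; 0; 3; 1; 1; 0];
      [:: 1; 1; 2; 3; 3; 3; 3; 3; 3; 3; 4; 3; 3]].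

Definition table_3_3 := [:: [:: 1; 2; 4]; [:: 5; 0; 0]; [:: 5; 3; 3]].

Definition table_3_5 :=
  [:: [:: 4; 0; 0; 4; 4]; [:: 1; 5; 3; 3; 1]; [:: 3; 2; 2; 5; 0]].

Definition blocks_table k bs bs' F :=
  star_table k (undup (flatten bs)) (undup (flatten bs'))
             (block_arc bs) (block_arc bs') F.

Lemma blocks_colorable k bs bs' F m n r s :
  blocks_table k bs bs' F ->
  loop (block_arc bs) r -> size r = m -> loop (block_arc bs') s -> size s = n ->
  star_colorable (torus m n) k.
Proof.
move=> T Lr <- Ls <-.
have arcN cs x y : block_arc cs x y -> x \in undup (flatten cs).
  by case/hasP=> b bP /andP[xb _]; rewrite mem_undup; apply/flattenP; exists b.
apply: (star_table_colorable (r := fun i => nth 0 r i) (s := fun i => nth 0 s i) T).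
- by move=> i; apply/arcN/loop_nth.
- by move=> i; apply/loop_nth.
- by move=> i; apply/arcN/loop_nth.
by move=> i; apply/loop_nth.
Qed.

Lemma table_3_3_ok : blocks_table 6 blocks3 blocks3 table_3_3.
Proof. by vm_compute. Qed.

Lemma table_3_5_ok : blocks_table 6 blocks3 blocks5 table_3_5.
Proof. by vm_compute. Qed.

Lemma table_3_4679_ok : blocks_table 5 blocks3 blocks4679 table_3_4679.
Proof. by vm_compute. Qed.

Lemma table_456_4567_ok : blocks_table 5 blocks456 blocks4567 table_456_4567.
Proof. by vm_compute. Qed.

Lemma table_7_4567_ok : blocks_table 5 blocks7 blocks4567 table_7_4567.
Proof. by vm_compute. Qed.

Lemma loop_block_size bs ws n :
  all (loop (block_arc bs)) (iota 0 4 :: ws) ->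
  has (fun r => (size r <= n) && (n == size r %[mod 4])) (iota 0 4 :: ws) ->
  exists2 r, loop (block_arc bs) r & size r = n.
Proof. by move=> L; apply: (loop_of_size (u := iota 0 4) _ L); case/andP: L. Qed.

Lemma loops4567 n : 4 <= n -> exists2 r, loop (block_arc blocks4567) r & size r = n.
Proof.
move=> n4; apply: (@loop_block_size _ (behead blocks4567)); first by vm_compute.
rewrite /=; lia.
Qed.

(** The shortest closed walk of length 3 modulo 4 has length 11 = 5 + 6. *)
Lemma loops456 n : 4 <= n -> n != 7 ->
  exists2 r, loop (block_arc blocks456) r & size r = n.
Proof.
move=> n4 n7; apply: (@loop_block_size _
  (rcons (behead blocks456) (nth [::] blocks456 1 ++ nth [::] blocks456 2))).
  by vm_compute.
rewrite /=; lia.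
Qed.

Lemma loops4679 n : 4 <= n -> n != 5 ->
  exists2 r, loop (block_arc blocks4679) r & size r = n.
Proof.
move=> n4 n5; apply: (@loop_block_size _ (behead blocks4679)); first by vm_compute.
rewrite /=; lia.
Qed.

Theorem theorem3 (m n : nat) (hm : 3 <= m) (hmn : m <= n) :
  star_chromatic_number (tensor_product (cycle_graph m) (cycle_graph n)) =
  if (m == 3) && ((n == 3) || (n == 5)) then 6 else 5.
Proof.
have n3 := leq_trans hm hmn.
have loop3 : loop (block_arc blocks3) (iota 0 3) by vm_compute.
have loop5 : loop (block_arc blocks5) (iota 0 5) by vm_compute.
have loop7 : loop (block_arc blocks7) (iota 0 7) by vm_compute.
case: ifP => [/andP[/eqP-> /pred2P[]->]|exc].
- apply: star_chromatic_number_eq torus33_not_star5.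
  exact: (blocks_colorable table_3_3_ok loop3 erefl loop3 erefl).
- apply: star_chromatic_number_eq torus35_not_star5.
  exact: (blocks_colorable table_3_5_ok loop3 erefl loop5 erefl).
apply: star_chromatic_number_eq; last first.
  case: m n hm n3 {hmn exc} => [|[|[|m]]] // [|[|[|n]]] // _ _.
  exact: torus_not_star4.
have [m3|m_neq3] := eqVneq m 3.
  move: exc; rewrite m3 eqxx /= => /norP[/eqP n_neq3 n_neq5].
  have [|s Ls sn] := loops4679 _ n_neq5; first by lia.
  exact: (blocks_colorable table_3_4679_ok loop3 erefl Ls sn).
have m4 : 4 <= m by rewrite ltn_neqAle eq_sym m_neq3.
have [s Ls sn] := loops4567 (leq_trans m4 hmn).
have [-> |m_neq7] := eqVneq m 7.
  exact: (blocks_colorable table_7_4567_ok loop7 erefl Ls sn).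
have [r Lr rm] := loops456 m4 m_neq7.
exact: (blocks_colorable table_456_4567_ok Lr rm Ls sn).
Qed.
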